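(* (i) For every $\varepsilon>0$ there is a sequence of instances $(\mathcal{T}_n,w_n)$ (finite trees with weight functions $w_n:V(\mathcal{T}_n)\to\mathbb{R}_{\ge0}$) with $w_n(\mathcal{T}_n)=1$ and $\lim_{n\to\infty}\mathtt{OPT}(\mathcal{T}_n,w_n)=\infty$, such that every centroid tree $C_n$ of $(\mathcal{T}_n,w_n)$ satisfies $$\mathtt{cost}_{w_n}(C_n)\ge 2\cdot\mathtt{OPT}(\mathcal{T}_n,w_n)-1-\varepsilon.$$ (ii) There is a sequence of instances $(\mathcal{T}_n,w_n)$, where $w_n$ is the uniform probability distribution on $V(\mathcal{T}_n)$, with $\lim_{n\to\infty}\mathtt{OPT}(\mathcal{T}_n,w_n)=\infty$, such that for every choice of centroid trees $C_n$ of $(\mathcal{T}_n,w_n)$, $$\lim_{n\to\infty}\frac{\mathtt{cost}_{w_n}(C_n)}{\mathtt{OPT}(\mathcal{T}_n,w_n)}=2.$$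
   Context: For a subgraph $\mathcal{H}$ of $\mathcal{T}$, $w(\mathcal{H})=\sum_{x\in V(\mathcal{H})}w(x)$. A search tree on a tree $\mathcal{T}$ is a rooted tree $T$ with vertex set $V(\mathcal{T})$ defined recursively: its root is an arbitrary vertex $r$, and the children of $r$ are the roots of search trees built on the connected components of $\mathcal{T}-r$; a single-vertex tree has only itself as search tree. $\mathtt{cost}_w(T)=\sum_x w(x)\,\mathtt{depth}_T(x)$ with root depth $1$; $\mathtt{OPT}(\mathcal{T},w)$ is the minimum cost over all search trees on $\mathcal{T}$. A vertex $v$ is a centroid of $(\mathcal{T},w)$ if each component $\mathcal{H}$ of $\mathcal{T}-v$ has $w(\mathcal{H})\le w(\mathcal{T})/2$. A search tree $T$ is a centroid tree if each vertex $x$ is a centroid of $(\mathcal{T}[V(T_x)],w)$, $T_x$ being the subtree of $T$ rooted at $x$. *)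

(* Defs.v *)
From HB Require Import structures.
From mathcomp Require Import all_boot all_order all_algebra.
From mathcomp Require Import boolp classical_sets reals Rstruct.
From Stdlib Require List.
Set Implicit Arguments. Unset Strict Implicit. Unset Printing Implicit Defensive.
Import Order.TTheory GRing.Theory Num.Theory.
Local Open Scope ring_scope.

Notation R := Rdefinitions.R.

Section Trees.
Variables (V : finType) (e : rel V).

Definition rrel (S : {set V}) : rel V := [rel x y | [&& x \in S, y \in S & e x y]].

Definition comp (S : {set V}) (x : V) : {set V} :=
  [set y in S | connect (rrel S) x y].

Definition components (S : {set V}) : {set {set V}} :=
  [set comp S x | x in S].

Definition is_tree : Prop :=
  [/\ symmetric e, irreflexive e, 0 < #|V|,
      (forall x y : V, connect e x y)
    & #|[set p : V * V | e p.1 p.2]| = (#|V| - 1).*2]%N.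

End Trees.

Inductive rtree (V : Type) : Type := RNode : V -> list (rtree V) -> rtree V.
Arguments RNode {V}.

Inductive stree_P (V : finType) (e : rel V) (P : {set V} -> V -> Prop)
  : {set V} -> rtree V -> Prop :=
| stP_node (S : {set V}) (r : V) (ts : list (rtree V)) (Hs : seq {set V}) :
    r \in S -> P S r ->
    List.Forall2 (stree_P e P) Hs ts ->
    perm_eq Hs (enum (components e (S :\ r))) ->
    stree_P e P S (RNode r ts).

Section Cost.
Variables (V : finType) (e : rel V) (w : V -> R).

Definition search_tree (t : rtree V) : Prop := stree_P e (fun _ _ => True) [set: V] t.

Fixpoint cost_at (d : R) (t : rtree V) : R :=
  match t with
  | RNode r ts => d * w r +
      (fix go (l : list (rtree V)) : R :=
         match l with nil => 0 | t' :: l' => cost_at (d + 1) t' + go l' end) ts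
  end.

Definition cost (t : rtree V) : R := cost_at 1 t.

Definition OPT : R := inf [set c | exists t, search_tree t /\ c = cost t].

Definition wsum (S : {set V}) : R := \sum_(x in S) w x.

Definition centroid (S : {set V}) (v : V) : Prop :=
  v \in S /\ forall H, H \in components e (S :\ v) -> wsum H <= wsum S / 2.

Definition centroid_tree (t : rtree V) : Prop := stree_P e centroid [set: V] t.

End Cost.

Record instance := Inst { inst_k : nat; inst_e : rel 'I_inst_k; inst_w : 'I_inst_k -> R }.

Definition I_OPT (I : instance) : R := OPT (@inst_e I) (@inst_w I).
Definition I_cost (I : instance) (t : rtree 'I_(inst_k I)) : R := cost (@inst_w I) t.
Definition I_centroid_tree (I : instance) (t : rtree 'I_(inst_k I)) : Prop :=
  centroid_tree (@inst_e I) (@inst_w I) t.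

Definition valid_instance (I : instance) : Prop :=
  is_tree (@inst_e I) /\ (forall x, 0 <= @inst_w I x) /\ wsum (@inst_w I) [set: 'I_(inst_k I)] = 1.

Definition uniform_instance (I : instance) : Prop :=
  is_tree (@inst_e I) /\ forall x, @inst_w I x = 1 / (#|'I_(inst_k I)|%:R).

Definition diverges (u : nat -> R) : Prop :=
  forall M : R, exists N, forall n, (N <= n)%N -> M <= u n.

Definition converges_to (u : nat -> R) (l : R) : Prop :=
  forall eps : R, 0 < eps -> exists N, forall n, (N <= n)%N -> `|u n - l| < eps.

(* Main.v *)
(* Let [W s = 2 ^ s.+1 - 1] and let [G n s] be the tree of weight [W s] defined as follows.
   For [n = 0] or [s = 0] it is a star (or a single heavy vertex); [G n.+1 s.+1] consists of
   [G n.+1 s] and [G n s], whose roots are both joined to a new vertex [c] of unit weight, and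
   its root is the root of [G n.+1 s].  The two halves have equal weight, so [c] is the only
   centroid, and a centroid tree is forced to bisect down to the stars, at a cost of about
   [2 n + 1] per unit of weight.  On the other hand, removing the root of [G n.+1 s] leaves
   only copies of the trees [G n _], each with a pendant vertex, at the price of a single
   level, so that about [n + 1] per unit of weight (plus one if the leaves of the stars are
   not weightless) is enough.  Both errors vanish as [s] grows.  Lower bounds on the optimum
   come from the inequality [cost C <= 2 * OPT - 1] for centroid trees [C], whose inductive
   step is [centroid_step]. *)

Require Import Defs.
From mathcomp Require Import all_boot all_order all_algebra.
From mathcomp Require Import boolp classical_sets reals Rstruct.
From mathcomp Require Import fintype finset lra ring zify.
Import Order.TTheory GRing.Theory Num.Theory.
Local Open Scope ring_scope.

Set Implicit Arguments.
Unset Strict Implicit.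
Unset Printing Implicit Defensive.

(** * Components and connected sets *)

Definition connected (V : finType) (e : rel V) (S : {set V}) : Prop :=
  {in S &, forall x y, connect (rrel e S) x y}.

Section Components.
Variables (V : finType) (e : rel V).
Hypothesis e_sym : symmetric e.
Implicit Types (S A B H X : {set V}) (x y c : V).

Lemma rrel_connect_sym S : connect_sym (rrel e S).
Proof. by apply: sym_connect_sym => x y; rewrite /rrel /= e_sym andbCA. Qed.

Lemma components_partition S : partition (components e S) S.
Proof.
apply: equivalence_partitionP => x y z _ _ _; split; first exact: connect0.
by move/(same_connect (rrel_connect_sym S)).
Qed.

Lemma component_sub S H : H \in components e S -> H \subset S.
Proof. by case/imsetP=> x _ ->; apply/subsetP => y; rewrite inE; case/andP. Qed.

Lemma component_neq0 S H : H \in components e S -> exists x, x \in H.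
Proof. by case/imsetP=> x xS ->; exists x; rewrite inE xS connect0. Qed.

Lemma connected_closed X (U : {set V}) x :
  connected e X -> x \in X -> x \in U ->
  (forall a b, a \in U -> a \in X -> b \in X -> e a b -> b \in U) -> X \subset U.
Proof.
move=> cX xX xU clU; apply/subsetP => y yX.
have /connectP[p] := cX x y xX yX.
elim: p x xX xU => [|z p IHp] x xX xU /=; first by move=> _ ->.
by case/andP=> /and3P[_ zX xz] /IHp; apply=> //; apply: clU xz.
Qed.

Lemma component_connected S H : H \in components e S -> connected e H.
Proof.
case/imsetP=> x xS ->{H} y z; rewrite !inE => /andP[yS xy] /andP[zS xz].
(* Induction on the path from its end: every prefix ends in the component of [x], so the path never
   leaves it. *)
have fromx u : connect (rrel e S) x u -> connect (rrel e (Defs.comp e S x)) x u.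
  case/connectP=> p; elim/last_ind: p u => [|p v IHp] u /=.
    by move=> _ ->; apply: connect0.
  rewrite rcons_path last_rcons => /andP[pp pv] ->{u}.
  have cp := IHp _ pp erefl; apply: connect_trans cp (connect1 _).
  have cxp : connect (rrel e S) x (last x p) by apply/connectP; exists p.
  case/and3P: (pv) => lS vS lv.
  by rewrite /rrel /= !inE lS vS lv cxp (connect_trans cxp (connect1 pv)).
apply: connect_trans (fromx _ xz).
by rewrite rrel_connect_sym; apply: fromx.
Qed.

Lemma connect_rrel_sub A B x y :
  A \subset B -> connect (rrel e A) x y -> connect (rrel e B) x y.
Proof.
move=> /subsetP sAB; apply: connect_sub => u v /and3P[/sAB uB /sAB vB uv].
by apply: connect1; rewrite /rrel /= uB vB uv.
Qed.

Lemma connected_sub_component S X x :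
  connected e X -> X \subset S -> x \in X -> X \subset Defs.comp e S x.
Proof.
move=> cX sXS xX; apply/subsetP => y yX.
by rewrite inE (subsetP sXS) //=; apply: connect_rrel_sub sXS (cX x y xX yX).
Qed.

Lemma comp_in_components S x : x \in S -> Defs.comp e S x \in components e S.
Proof. exact: imset_f. Qed.

Lemma mem_comp_self S x : x \in S -> x \in Defs.comp e S x.
Proof. by move=> xS; rewrite inE xS connect0. Qed.

Lemma comp_eq S H x : H \in components e S -> x \in H -> Defs.comp e S x = H.
Proof.
move=> HS xH; have /and3P[_ tI _] := components_partition S.
have xS := subsetP (component_sub HS) x xH.
by rewrite -(def_pblock tI HS xH) (def_pblock tI (comp_in_components xS) (mem_comp_self xS)).
Qed.

Lemma connected_hub S c :
  c \in S -> (forall x, x \in S -> connect (rrel e S) c x) -> connected e S.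
Proof.
move=> cS hub x y xS yS; apply: connect_trans (hub y yS).
by rewrite rrel_connect_sym; apply: hub.
Qed.

Lemma connectedU1 A c r : connected e A -> r \in A -> e c r -> connected e (c |: A).
Proof.
move=> cA rA cr; apply: (@connected_hub _ c); first exact: setU11.
move=> x /setU1P[->|xA]; first exact: connect0.
apply: connect_trans (connect_rrel_sub (subsetU1 _ _) (cA r x rA xA)).
by apply: connect1; rewrite /rrel /= setU11 setU1r.
Qed.

Lemma components_setU A B a b : connected e A -> connected e B ->
  a \in A -> b \in B -> [disjoint A & B] ->
  {in A & B, forall x y, ~~ e x y} ->
  components e (A :|: B) = [set A; B].
Proof.
move=> cA cB aA bB dAB nAB.
have half (C D : {set V}) c x : connected e C -> c \in C -> [disjoint C & D] ->
    {in C & D, forall x y, ~~ e x y} -> x \in C -> Defs.comp e (C :|: D) x = C.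
  move=> cC cC' dCD nCD xC; apply/eqP; rewrite eqEsubset.
  have xCD : x \in C :|: D by rewrite inE xC.
  rewrite (connected_sub_component cC) ?subsetUl // andbT.
  apply: (connected_closed (component_connected (comp_in_components xCD))
    (mem_comp_self xCD) xC) => u v uC _.
  rewrite inE => /andP[/setUP[//|vD] _] uv.
  by have := nCD u v uC vD; rewrite uv.
have halfA x : x \in A -> Defs.comp e (A :|: B) x = A by apply: (half A B a).
have halfB x : x \in B -> Defs.comp e (A :|: B) x = B.
  rewrite setUC; apply: (half B A b) => //; first by rewrite disjoint_sym.
  by move=> u v uB vA; rewrite e_sym; apply: nAB.
apply/setP => H; rewrite !inE; apply/imsetP/orP.
  by case=> x /setUP[/halfA->|/halfB->] ->; [left|right].
by case=> /eqP->; [exists a|exists b]; rewrite ?(halfA a) ?(halfB b) ?(inE, aA, bB, orbT).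
Qed.

Lemma card_component S r H : r \in S -> H \in components e (S :\ r) -> (#|H| < #|S|)%N.
Proof.
move=> rS HS; rewrite (cardsD1 r S) rS add1n ltnS.
exact: subset_leq_card (component_sub HS).
Qed.

Lemma component_sub_set S r H : H \in components e (S :\ r) -> {subset H <= S}.
Proof. by move=> /component_sub sH x /(subsetP sH); rewrite inE; case/andP. Qed.

End Components.

(** * Costs of search trees *)

Section Costs.
Variables (V : finType) (e : rel V) (w : V -> R).
Hypothesis e_sym : symmetric e.
Hypothesis w_ge0 : forall x, 0 <= w x.
Implicit Types (P : {set V} -> V -> Prop) (S A B H X : {set V}) (x y r c : V) (t : rtree V).

Lemma sum_components S (E : V -> R) :
  \sum_(x in S) E x = \sum_(H in components e S) \sum_(x in H) E x.
Proof. exact: set_partition_big (components_partition e_sym S). Qed.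

Lemma wsum_ge0 S : 0 <= wsum w S.
Proof. exact: sumr_ge0. Qed.

Lemma wsumD1 S r : r \in S -> wsum w S = w r + wsum w (S :\ r).
Proof. exact: big_setD1. Qed.

Lemma wsumU1 S r : r \notin S -> wsum w (r |: S) = w r + wsum w S.
Proof. exact: big_setU1. Qed.

Lemma wsum_sub A B : A \subset B -> wsum w A <= wsum w B.
Proof.
move=> /setIidPr AB; rewrite -AB {2}/wsum (big_setID A) /= lerDl.
exact: sumr_ge0.
Qed.

Lemma cost_at_node (d : R) r (ts : list (rtree V)) :
  cost_at w d (RNode r ts) = d * w r + \sum_(t <- ts) cost_at w (d + 1) t.
Proof.
rewrite /=; congr (_ + _); elim: ts => [|t ts IH]; first by rewrite big_nil.
by rewrite big_cons IH.
Qed.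

(** [stree_P] is nested through [List.Forall2]; the inner induction hands the derivation of each
    child to the recursive call, so that [Q] is available for all children. *)
Lemma stree_nested_ind P (Q : {set V} -> rtree V -> Prop) :
  (forall S r ts Hs, r \in S -> P S r ->
     List.Forall2 (stree_P e P) Hs ts -> List.Forall2 Q Hs ts ->
     perm_eq Hs (enum (components e (S :\ r))) -> Q S (RNode r ts)) ->
  forall S t, stree_P e P S t -> Q S t.
Proof.
move=> IH; fix rec 3 => S t [{}S r ts Hs rS PS fst pe].
refine (IH _ _ _ _ rS PS fst _ pe).
elim: {pe} Hs ts / fst => [|H t' Hs ts Ht _ IHf]; first exact: List.Forall2_nil.
by apply: List.Forall2_cons IHf; apply: rec.
Qed.

Lemma Forall2_sum (Q : {set V} -> rtree V -> Prop) (F : {set V} -> R) (G : rtree V -> R) Hs ts :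
  List.Forall2 Q Hs ts -> (forall H t, Q H t -> G t = F H) ->
  \sum_(t <- ts) G t = \sum_(H <- Hs) F H.
Proof.
move=> f2 QG; elim: Hs ts / f2 => [|H t Hs ts Ht _ IH]; rewrite ?big_nil //.
by rewrite !big_cons IH (QG H).
Qed.

Lemma cost_at_shift P S t : stree_P e P S t ->
  forall d, cost_at w (d + 1) t = cost_at w d t + wsum w S.
Proof.
elim/stree_nested_ind => {}S r ts Hs rS _ _ fQ pe d.
have sumHs : wsum w (S :\ r) = \sum_(H <- Hs) wsum w H.
  by rewrite (perm_big _ pe) big_enum; apply: sum_components.
rewrite !cost_at_node (wsumD1 rS) sumHs.
have -> : \sum_(H <- Hs) wsum w H =
    \sum_(t' <- ts) (cost_at w (d + 1 + 1) t' - cost_at w (d + 1) t').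
  by apply/esym/(Forall2_sum fQ) => H t' ->; rewrite addrAC subrr add0r.
by rewrite sumrB; lra.
Qed.

(** Distinctness of the components lets the subtrees be indexed by them, which turns sums over
    children into sums over [components]; [t0] is a default value. *)
Lemma Forall2_lookup (Q : {set V} -> rtree V -> Prop) (t0 : rtree V) Hs ts :
  List.Forall2 Q Hs ts -> uniq Hs ->
  exists f : {set V} -> rtree V, ts = map f Hs /\ {in Hs, forall H, Q H (f H)}.
Proof.
move=> f2; elim: Hs ts / f2 => [|H t Hs ts Ht _ IH] /=; first by exists (fun=> t0).
case/andP=> nH /IH[f [-> fQ]].
exists (fun K => if K == H then t else f K); split; first last.
  by move=> K; rewrite inE; case: eqP => [->|_ /fQ].
rewrite eqxx; congr (_ :: _); apply/eq_in_map => K KH.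
by case: eqP => // eKH; rewrite -eKH KH in nH.
Qed.

Lemma stree_inv P S t : stree_P e P S t ->
  exists r (f : {set V} -> rtree V), [/\ r \in S, P S r,
    {in components e (S :\ r), forall H, stree_P e P H (f H)} &
    cost w t = wsum w S + \sum_(H in components e (S :\ r)) cost w (f H)].
Proof.
(* At starting depth 0 the root is free and its children sit at depth 1, so each of them contributes
   its own [cost]. *)
move=> tS; have := cost_at_shift tS 0; rewrite add0r => costE.
case: tS costE => {}S r ts Hs rS PS fst pe costE.
have [|f [tsE fP]] := Forall2_lookup (RNode r ts) fst.
  by rewrite (perm_uniq pe) enum_uniq.
exists r, f; split=> // [H HS|].
  by apply: fP; rewrite (perm_mem pe) mem_enum.
rewrite /cost costE addrC; congr (_ + _).
rewrite cost_at_node mul0r !add0r tsE big_map.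
by rewrite (perm_big _ pe) big_enum.
Qed.

Lemma stree_build P S r (f : {set V} -> rtree V) : r \in S -> P S r ->
  {in components e (S :\ r), forall H, stree_P e P H (f H)} ->
  exists2 t, stree_P e P S t &
    cost w t = wsum w S + \sum_(H in components e (S :\ r)) cost w (f H).
Proof.
move=> rS PS fP; pose Hs := enum (components e (S :\ r)).
have tS : stree_P e P S (RNode r (map f Hs)).
  apply: (stP_node rS PS _ (perm_refl Hs)).
  have: {subset Hs <= components e (S :\ r)} by move=> H; rewrite mem_enum.
  elim: Hs => [|H Hs IH] sub; first exact: List.Forall2_nil.
  apply: List.Forall2_cons.
    by apply: fP; apply: sub; rewrite inE eqxx.
  by apply: IH => K KHs; apply: sub; rewrite inE KHs orbT.
exists (RNode r (map f Hs)) => //.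
have := cost_at_shift tS 0; rewrite add0r /cost => ->; rewrite addrC; congr (_ + _).
by rewrite cost_at_node mul0r !add0r big_map big_enum.
Qed.

Lemma wsum_le_cost P S t : stree_P e P S t -> wsum w S <= cost w t.
Proof.
have [n] := ubnP #|S|; elim: n => // n IHn in S t *; rewrite ltnS => leSn.
case/stree_inv=> r [f [rS _ fP ->]]; rewrite lerDl; apply: sumr_ge0 => H HS.
apply: le_trans (wsum_ge0 H) (IHn _ _ _ (fP H HS)).
exact: leq_trans (card_component rS HS) leSn.
Qed.

End Costs.

(** * Rankings *)

(* The depth functions of search trees on [S] are, up to increasing the values, the functions
   with a unique minimum on every connected subset. *)
Definition ranking (V : finType) (e : rel V) (S : {set V}) (d : V -> R) : Prop :=
  {in S, forall x, 1 <= d x} /\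
  forall X : {set V}, X \subset S -> connected e X -> X != set0 ->
    exists2 r, r \in X & {in X, forall x, x != r -> d r + 1 <= d x}.

Section Rankings.
Variables (V : finType) (e : rel V) (w : V -> R).
Hypothesis e_sym : symmetric e.
Hypothesis w_ge0 : forall x, 0 <= w x.
Implicit Types (P : {set V} -> V -> Prop) (S A B H X : {set V}) (x y r c : V) (d : V -> R).

(** The depth function works: a connected [X] has its minimum at the root if it contains it, and
    otherwise lies in a single component, where induction applies. *)
Lemma ranking_of_stree P S t : stree_P e P S t ->
  exists2 d, ranking e S d & cost w t = \sum_(x in S) w x * d x.
Proof.
have [n] := ubnP #|S|; elim: n => // n IHn in S t *; rewrite ltnS => leSn.
case/(stree_inv w e_sym)=> r [f [rS _ fP ->]].
have /choice[D DP] H : exists d, H \in components e (S :\ r) ->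
    ranking e H d /\ cost w (f H) = \sum_(x in H) w x * d x.
  have [HS|nHS] := boolP (H \in components e (S :\ r)); last by exists (fun=> 1).
  have [|d dP dE] := IHn H (f H) _ (fP H HS); last by exists d.
  exact: leq_trans (card_component rS HS) leSn.
pose d x := if x == r then 1 else 1 + D (Defs.comp e (S :\ r) x) x.
have dH H x : H \in components e (S :\ r) -> x \in H -> d x = 1 + D H x.
  move=> HS xH; rewrite /d (comp_eq e_sym HS xH); case: eqP => // xr.
  by have := subsetP (component_sub HS) x xH; rewrite xr !inE eqxx.
have compx x : x \in S -> x != r ->
    Defs.comp e (S :\ r) x \in components e (S :\ r) /\ x \in Defs.comp e (S :\ r) x.
  move=> xS xr; have xSr : x \in S :\ r by rewrite !inE xr.
  by split; [apply: comp_in_components | apply: mem_comp_self].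
have d_ge2 x : x \in S -> x != r -> 2 <= d x.
  move=> xS xr; have [CS xC] := compx x xS xr; rewrite (dH _ _ CS xC).
  by have [[/(_ x xC) ? _] _] := DP _ CS; lra.
exists d.
  split=> [x xS|X XS cX X0].
    have [->|xr] := eqVneq x r; first by rewrite /d eqxx.
    by have := d_ge2 x xS xr; lra.
  have [rX|rX] := boolP (r \in X).
    exists r => // x xX xr; rewrite {1}/d eqxx.
    by have := d_ge2 x (subsetP XS x xX) xr; lra.
  have [y yX] := set0Pn _ X0.
  have yr : y != r by apply: contraNneq rX => <-.
  have [CS yC] := compx y (subsetP XS y yX) yr.
  have XSr : X \subset S :\ r by rewrite subsetD1 XS.
  have XC := connected_sub_component cX XSr yX.
  have [[_ /(_ X XC cX X0)[m mX mP]] _] := DP _ CS.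
  exists m => // x xX xm; rewrite !(dH _ _ CS) ?(subsetP XC) //.
  by have := mP x xX xm; lra.
rewrite (wsumD1 w rS) (big_setD1 r rS) /= {1}/d eqxx mulr1 -addrA; congr (_ + _).
rewrite /wsum !(sum_components e_sym (S :\ r)) -big_split /=; apply: eq_bigr => H HS.
have [_ ->] := DP H HS; rewrite -big_split /=; apply: eq_bigr => x xH.
by rewrite (dH _ _ HS xH) mulrDr mulr1.
Qed.

Lemma ranking_sub S H d : H \subset S -> ranking e S d -> ranking e H d.
Proof.
move=> HS [d1 dP]; split=> [x /(subsetP HS)/d1 //|X XH].
by apply: dP; apply: subset_trans HS.
Qed.

Lemma ranking_shift S H d r : H \subset S -> r \notin H -> 1 <= d r ->
  {in S, forall x, x != r -> d r + 1 <= d x} ->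
  ranking e S d -> ranking e H (fun x => d x - 1).
Proof.
move=> HS rH dr rP [d1 dP]; split=> [x xH|X XH cX X0].
  have xr : x != r by apply: contraNneq rH => <-.
  by have := rP x (subsetP HS x xH) xr; lra.
have [m mX mP] := dP X (subset_trans XH HS) cX X0.
by exists m => // x xX /(mP x xX); lra.
Qed.

Lemma sum_shift H d : \sum_(x in H) w x * (d x - 1) = \sum_(x in H) w x * d x - wsum w H.
Proof. by rewrite -sumrB; apply: eq_bigr => x _; rewrite mulrBr mulr1. Qed.

(** The minimum of [d] on [S] serves as root; all other ranks exceed it by at least 1, so they can
    be lowered by 1 before recursing. Only an inequality results, since ranks may exceed depths. *)
Lemma stree_of_ranking S d : S != set0 -> connected e S -> ranking e S d ->
  exists2 t, stree_P e (fun _ _ => True) S t & cost w t <= \sum_(x in S) w x * d x.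
Proof.
have [n] := ubnP #|S|; elim: n => // n IHn in S d *; rewrite ltnS => leSn S0 cS dS.
have [r rS rP] := dS.2 S (subxx S) cS S0.
have /choice[f fP] H : exists t, H \in components e (S :\ r) ->
    stree_P e (fun _ _ => True) H t /\ cost w t <= \sum_(x in H) w x * (d x - 1).
  have [HS|nHS] := boolP (H \in components e (S :\ r)); last by exists (RNode r [::]).
  have [||||t tP tc] := IHn H (fun x => d x - 1); last by exists t.
  - exact: leq_trans (card_component rS HS) leSn.
  - by apply/set0Pn; apply: component_neq0 HS.
  - exact: component_connected HS.
  have := component_sub HS; rewrite subsetD1 => /andP[subH rH].
  exact: ranking_shift subH rH (dS.1 r rS) rP dS.
have [|t tS tc] := stree_build w e_sym rS I (P := fun _ _ => True) (f := f).
  by move=> H /fP[].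
exists t => //; rewrite tc.
have leF : \sum_(H in components e (S :\ r)) cost w (f H) <=
    \sum_(H in components e (S :\ r)) \sum_(x in H) w x * (d x - 1).
  by apply: ler_sum => H /fP[].
move: leF; rewrite -(sum_components e_sym) sum_shift (wsumD1 w rS) (big_setD1 r rS) /=.
have : w r <= w r * d r by rewrite ler_peMr ?dS.1.
lra.
Qed.

(* Relative to any ranking, cutting at a centroid moves at least half of the weight one level
   up, since only the component containing the minimum of the ranking keeps its ranks. *)
Lemma centroid_step S c d (K : {set V} -> R) :
  connected e S -> centroid e w S c -> ranking e S d ->
  (forall H d', H \in components e (S :\ c) -> ranking e H d' ->
     K H + wsum w H <= 2 * \sum_(x in H) w x * d' x) ->
  wsum w S + \sum_(H in components e (S :\ c)) K H + wsum w S <= 2 * \sum_(x in S) w x * d x.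
Proof.
move=> cS [cinS cent] dS KP.
have S0 : S != set0 by apply/set0Pn; exists c.
have [r rS rP] := dS.2 S (subxx S) cS S0.
(* A component avoiding the minimum [r] may be ranked by [d - 1], which saves twice its weight. *)
have stepH H : H \in components e (S :\ c) ->
    K H + wsum w H + 2 * (if r \in H then 0 else wsum w H) <= 2 * \sum_(x in H) w x * d x.
  move=> HS; have HS' : H \subset S.
    by apply/subsetP; apply: component_sub_set HS.
  have [rH|rH] := boolP (r \in H).
    by rewrite mulr0 addr0; apply: KP => //; apply: ranking_sub dS.
  have := KP H _ HS (ranking_shift HS' rH (dS.1 r rS) rP dS).
  by rewrite sum_shift; lra.
have /ler_sum := stepH; move/(_ (index_enum _)).
rewrite big_split /= big_split /= -mulr_sumr -mulr_sumr -!(sum_components e_sym).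
rewrite -/(wsum w (S :\ c)) (big_setD1 c cinS) /=.
rewrite (wsumD1 w cinS) in cent *.
set lost := \sum_(H in _) (if _ then _ else _) => sumK.
have wc := w_ge0 c; have d_c : w c <= w c * d c by rewrite ler_peMr ?dS.1.
have wSc : wsum w (S :\ c) = \sum_(H in components e (S :\ c)) wsum w H.
  exact: sum_components.
have [rc|rc] := eqVneq r c.
  have lostE : lost = wsum w (S :\ c).
    rewrite wSc; apply: eq_bigr => H HS; rewrite ifN // rc.
    by have := component_sub HS; rewrite subsetD1 => /andP[].
  by rewrite lostE in sumK; have := wsum_ge0 w_ge0 (S :\ c); lra.
have d_c2 : w c * 2 <= w c * d c.
  apply: ler_wpM2l => //.
  by have := rP c cinS; rewrite eq_sym => /(_ rc); have := dS.1 r rS; lra.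
have rSc : r \in S :\ c by rewrite !inE rc.
have H0S := comp_in_components e rSc.
(* Everything outside [c] and the component of [r] is saved; that component weighs at most half of
   [S], and [c] has rank at least 2. *)
have lostE : wsum w (S :\ c) - wsum w (Defs.comp e (S :\ c) r) <= lost.
  rewrite wSc /lost (bigD1 (Defs.comp e (S :\ c) r)) //=.
  rewrite [X in _ <= X](bigD1 (Defs.comp e (S :\ c) r)) //=.
  rewrite mem_comp_self // add0r addrAC subrr add0r; apply: ler_sum => H /andP[HS HC].
  rewrite ifN //; apply: contra HC => rH.
  by rewrite (comp_eq e_sym HS rH).
have := cent _ H0S; lra.
Qed.

(** For [d] the depth function of a search tree [T] and total weight 1 this reads
    [cost C <= 2 * cost T - 1]. Arbitrary rankings are allowed because the induction restricts and
    shifts [d]. *)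
Lemma centroid_tree_le S t d : connected e S -> stree_P e (centroid e w) S t ->
  ranking e S d -> cost w t + wsum w S <= 2 * \sum_(x in S) w x * d x.
Proof.
have [n] := ubnP #|S|; elim: n => // n IHn in S t d *; rewrite ltnS => leSn cS tS dS.
have [c [f [cinS cent fP ->]]] := stree_inv w e_sym tS.
apply: (centroid_step cS cent dS (K := fun H => cost w (f H))) => H d' HS dH.
apply: IHn dH; last exact: fP.
  exact: leq_trans (card_component cinS HS) leSn.
exact: component_connected HS.
Qed.

End Rankings.

(** * Gluing two trees along a new vertex *)

Definition glued (V : finType) (e : rel V) (c rA rB : V) (A B : {set V}) : Prop :=
  [/\ c \notin A, c \notin B, [disjoint A & B] &
  [/\ {in A, forall x, e c x = (x == rA)}, {in B, forall x, e c x = (x == rB)}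
    & {in A & B, forall x y, ~~ e x y}]].

Section Gluing.
Variables (V : finType) (e : rel V) (w : V -> R).
Hypothesis e_sym : symmetric e.
Hypothesis w_ge0 : forall x, 0 <= w x.
Variables (c rA rB : V) (A B : {set V}).
Hypotheses (rAA : rA \in A) (rBB : rB \in B).
Hypotheses (cA : connected e A) (cB : connected e B).
Hypothesis gAB : glued e c rA rB A B.

Let S := c |: (A :|: B).

Lemma glued_notin : c \notin A :|: B.
Proof. by have [nA nB _ _] := gAB; rewrite inE negb_or nA. Qed.

Lemma glued_connected : connected e S.
Proof.
have [_ _ _ [eA eB _]] := gAB.
apply: (connected_hub e_sym (c := c)) => [|x]; first exact: setU11.
rewrite !inE => /or3P[/eqP->|xA|xB]; first exact: connect0.
  have sub : c |: A \subset S by rewrite setUS ?subsetUl.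
  apply: connect_rrel_sub sub (connectedU1 e_sym cA rAA _ _ _); rewrite ?eA ?eqxx //.
    exact: setU11.
  exact: setU1r.
have sub : c |: B \subset S by rewrite setUS ?subsetUr.
apply: connect_rrel_sub sub (connectedU1 e_sym cB rBB _ _ _); rewrite ?eB ?eqxx //.
  exact: setU11.
exact: setU1r.
Qed.

Lemma glued_components : components e (S :\ c) = [set A; B].
Proof.
have [_ _ dAB [_ _ nAB]] := gAB.
by rewrite setU1K ?glued_notin //; exact: (components_setU e_sym cA cB rAA rBB dAB nAB).
Qed.

Lemma glued_neq : A != B.
Proof.
have [_ _ dAB _] := gAB; apply: contraTneq rAA => ->.
by have /pred0P/(_ rA) := dAB; rewrite /= rAA /= => ->.
Qed.

Lemma sum_glued_components (F : {set V} -> R) :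
  \sum_(H in components e (S :\ c)) F H = F A + F B.
Proof. by rewrite glued_components big_setU1 ?big_set1 // inE glued_neq. Qed.

Lemma glued_big (M : Type) (idx : M) (op : Monoid.com_law idx) (E : V -> M) :
  \big[op/idx]_(x in S) E x =
  op (E c) (op (\big[op/idx]_(x in A) E x) (\big[op/idx]_(x in B) E x)).
Proof.
have [_ _ dAB _] := gAB; rewrite big_setU1 ?glued_notin //=; congr (op _ _).
by rewrite -bigU //; apply: eq_bigl => x; rewrite !inE.
Qed.

Lemma glued_sum (E : V -> R) :
  \sum_(x in S) E x = E c + (\sum_(x in A) E x + \sum_(x in B) E x).
Proof. exact: glued_big. Qed.

Lemma glued_centroid : wsum w A = wsum w B -> centroid e w S c.
Proof.
move=> eAB; split=> [|H]; first exact: setU11.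
have -> : wsum w S = w c + (wsum w A + wsum w B) by exact: glued_sum.
rewrite glued_components !inE => /orP[]/eqP->; have := w_ge0 c; lra.
Qed.

End Gluing.

Lemma glued_sym (V : finType) (e : rel V) c rA rB A B :
  symmetric e -> glued e c rA rB A B -> glued e c rB rA B A.
Proof.
move=> e_sym [nA nB dAB [eA eB nAB]]; split; rewrite // 1?disjoint_sym //.
by split=> // x y xB yA; rewrite e_sym; apply: nAB.
Qed.

(** * Uniqueness of the centroid and rankings of a glued tree *)

Section GluedCentroid.
Variables (V : finType) (e : rel V) (w : V -> R).
Hypothesis e_sym : symmetric e.
Hypothesis w_ge0 : forall x, 0 <= w x.

(** If [v] were in [A], the connected set [c |: B] would lie in one component left by [v]; as the
    halves balance and [c] has positive weight, it weighs more than half. *)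
Lemma glued_centroid_notin c rA rB (A B : {set V}) v :
  rB \in B -> connected e B -> glued e c rA rB A B -> 0 < w c ->
  wsum w A = wsum w B -> centroid e w (c |: (A :|: B)) v -> v \notin A.
Proof.
move=> rBB cB gAB wc eAB [vS cent]; apply/negP => vA.
have [nA nB dAB [_ eB _]] := gAB.
have cBc : connected e (c |: B) by apply: (connectedU1 e_sym cB rBB); rewrite eB.
have sub : c |: B \subset (c |: (A :|: B)) :\ v.
  rewrite subsetD1 setUS ?subsetUr //= !inE negb_or.
  rewrite (contraNneq _ nA) => [|<- //].
  by have /pred0P/(_ v) := dAB; rewrite /= vA /= => ->.
have cS : c \in (c |: (A :|: B)) :\ v := subsetP sub c (setU11 _ _).
have := cent _ (comp_in_components e cS).
have := wsum_sub w_ge0 (connected_sub_component cBc sub (setU11 _ _)).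
rewrite wsumU1 // [X in _ -> _ <= X / 2 -> _](glued_sum gAB) -!/(wsum _ _); lra.
Qed.

Lemma glued_centroid_unique c rA rB (A B : {set V}) v :
  rA \in A -> rB \in B -> connected e A -> connected e B ->
  glued e c rA rB A B -> 0 < w c -> wsum w A = wsum w B ->
  centroid e w (c |: (A :|: B)) v -> v = c.
Proof.
move=> rAA rBB cA cB gAB wc eAB cent.
have vA := glued_centroid_notin rBB cB gAB wc eAB cent.
have vB : v \notin B.
  apply: glued_centroid_notin rAA cA (glued_sym e_sym gAB) wc (esym eAB) _.
  by rewrite (setUC B).
have [] := cent; rewrite !inE (negPf vA) (negPf vB) !orbF => /eqP ->.
by [].
Qed.

(* The vertex [c] becomes isolated once [rA] (of rank 1) and [rB] (of rank 2) are removed, so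
   it can be given rank 3. *)
Lemma glued_ranking c rA rB (A B : {set V}) (dA dB : V -> R) :
  glued e c rA rB A B -> rA \in A -> rB \in B ->
  ranking e A dA -> ranking e B dB -> dA rA = 1 -> dB rB = 1 ->
  {in A, forall x, x != rA -> 2 <= dA x} -> {in B, forall x, x != rB -> 2 <= dB x} ->
  exists2 d : V -> R, ranking e (c |: (A :|: B)) d &
    [/\ d c = 3, {in A, d =1 dA} & {in B, forall x, d x = dB x + 1}].
Proof.
move=> gAB rAA rBB rkA rkB dA1 dB1 dA2 dB2.
have [nA nB dAB [eA eB nAB]] := gAB.
pose d x := if x \in A then dA x else if x \in B then dB x + 1 else 3.
have dc : d c = 3 by rewrite /d (negPf nA) (negPf nB).
have dEA : {in A, d =1 dA} by move=> x xA; rewrite /d xA.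
have dEB : {in B, forall x, d x = dB x + 1}.
  move=> x xB; have /pred0P/(_ x) := dAB; rewrite /= xB andbT => xA.
  by rewrite /d xA xB.
exists d; split=> // [x|X XS cX X0].
  rewrite !inE => /or3P[/eqP->|xA|xB]; first by rewrite dc; lra.
    by rewrite dEA //; apply: rkA.1.
  by rewrite dEB //; have := rkB.1 x xB; lra.
have XE x : x \in X -> [|| x == c, x \in A | x \in B].
  by move/(subsetP XS); rewrite !inE.
have [rAX|rAX] := boolP (rA \in X).
  exists rA => // x xX xr; rewrite [d rA]dEA // dA1.
  case/or3P: (XE x xX) => [/eqP->|xA|xB]; first by rewrite dc; lra.
    by rewrite dEA //; have := dA2 x xA xr; lra.
  by rewrite dEB //; have := rkB.1 x xB; lra.
have [XA|/subsetPn[y yX yA]] := boolP (X \subset A).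
  have [m mX mP] := rkA.2 X XA cX X0; exists m => // x xX.
  by rewrite !dEA ?(subsetP XA) //; apply: mP.
(* Without [rA], the set [X] cannot pass between [A] and [c]; having a vertex outside [A], it avoids
   [A] altogether. *)
have XcB : X \subset c |: B.
  apply: (connected_closed cX yX) => [|a b].
    by rewrite !inE; have := XE y yX; rewrite (negPf yA).
  rewrite !inE => aU aX bX ab; case/or3P: (XE b bX) => [->//|bA|->]; last by rewrite orbT.
  case/orP: aU ab => [/eqP->|aB]; first by rewrite eA // => /eqP bE; rewrite -bE bX in rAX.
  by rewrite e_sym (negPf (nAB _ _ bA aB)).
have XE' x : x \in X -> (x == c) || (x \in B) by move/(subsetP XcB); rewrite !inE.
have [rBX|rBX] := boolP (rB \in X).
  exists rB => // x xX xr; rewrite [d rB]dEB // dB1.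
  case/orP: (XE' x xX) => [/eqP->|xB]; first by rewrite dc; lra.
  by rewrite dEB //; have := dB2 x xB xr; lra.
have [XB|/subsetPn[z zX zB]] := boolP (X \subset B).
  have [m mX mP] := rkB.2 X XB cX X0; exists m => // x xX xm.
  by rewrite !dEB ?(subsetP XB) //; have := mP x xX xm; lra.
have zc : z = c by have := XE' z zX; rewrite (negPf zB) orbF => /eqP.
rewrite {}zc in zX.
have Xc : X \subset [set c].
  apply: (connected_closed cX zX (set11 c)) => a b /set1P-> _ bX.
  rewrite inE; case/orP: (XE' b bX) => [//|bB]; rewrite eB // => /eqP bE.
  by rewrite -bE bX in rBX.
by exists c => // x /(subsetP Xc)/set1P->; rewrite eqxx.
Qed.

End GluedCentroid.

(** * The lower bound instances *)

Definition size_of (s : nat) : R := 2 ^+ s.+1 - 1.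

(* In both bounds, the terms with [(3 / 2) ^+ s] absorb the additive constants that accumulate
   along the recursion; they are negligible with respect to [size_of s]. *)
Definition centroid_bound (n s : nat) : R :=
  (2 * n%:R + 1) * size_of s - 6 * 2 ^+ n * (3 / 2) ^+ s + (2 * n%:R + 2).

Definition opt_bound (b : R) (n s : nat) : R :=
  (n%:R + 1 + b) * size_of s + 2 ^+ n * (3 / 2) ^+ s - 1.

Lemma size_ofS s : size_of s.+1 = 2 * size_of s + 1.
Proof. by rewrite /size_of exprS; lra. Qed.

Lemma size_of_ge1 s : 1 <= size_of s.
Proof.
elim: s => [|s IHs]; first by rewrite /size_of expr1; lra.
by rewrite size_ofS; lra.
Qed.

Lemma exp2_geS n : n%:R + 1 <= 2 ^+ n :> R.
Proof. by rewrite natr1 -natrX ler_nat ltn_expl. Qed.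

Lemma centroid_bound_base n s : (n == 0)%N || (s == 0)%N -> centroid_bound n s <= size_of s.
Proof.
rewrite /centroid_bound; case/orP=> /eqP->.
  have : 1 <= (3 / 2) ^+ s :> R by apply: exprn_ege1; lra.
  by rewrite expr0; lra.
have := exp2_geS n; have : 0 <= n%:R :> R by [].
by rewrite /size_of expr0 expr1; lra.
Qed.

(** An equality in fact: since [2 * (3 / 2) = 2 + 1], the error term satisfies the recursion
    exactly, and the additive [2 * n + 2] compensates the [+ 1] of [size_ofS]. *)
Lemma centroid_boundS n s :
  centroid_bound n.+1 s.+1 <= size_of s.+1 + centroid_bound n.+1 s + centroid_bound n s.
Proof.
rewrite /centroid_bound size_ofS -natr1 !exprS.
set W := size_of s; set x := 2 ^+ n; set y := _ ^+ s; set m := n%:R.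
by rewrite -subr_ge0 [leRHS](_ : _ = 0) //; field.
Qed.

Lemma opt_bound_base b n s : 0 <= b -> (n == 0)%N || (s == 0)%N ->
  (1 + b) * size_of s <= opt_bound b n s.
Proof.
move=> b0; rewrite /opt_bound; case/orP=> /eqP->.
  have : 1 <= (3 / 2) ^+ s :> R by apply: exprn_ege1; lra.
  by rewrite expr0; lra.
have : 1 <= 2 ^+ n :> R by apply: exprn_ege1; lra.
have : 0 <= n%:R :> R by [].
by rewrite /size_of expr0 expr1; lra.
Qed.

(** The left-hand side bounds the cost of the ranking from [glued_ranking]: both halves, one extra
    level for the second, and rank 3 for the unit weight of [c]. *)
Lemma opt_boundS b n s : 0 <= b ->
  opt_bound b n.+1 s + opt_bound b n s + size_of s + 3 <= opt_bound b n.+1 s.+1.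
Proof.
move=> b0; rewrite /opt_bound size_ofS -natr1 !exprS.
set W := size_of s; set x := 2 ^+ n; set y := _ ^+ s.
have : 0 <= n%:R :> R by []. set m := n%:R => m0.
rewrite -subr_ge0 [leRHS](_ : _ = m + b); first exact: addr_ge0.
by field.
Qed.

(* [q] is the weight of a vertex joining two halves, and [b] bounds the fraction of the
   weight of a star that its leaves may carry. *)
Inductive gadget (V : finType) (e : rel V) (w : V -> R) (q b : R) :
    nat -> nat -> V -> {set V} -> Prop :=
| gadget_star n s r (L : {set V}) :
    (n == 0)%N || (s == 0)%N -> r \notin L -> wsum w (r |: L) = q * size_of s ->
    wsum w L <= b * (q * size_of s) ->
    {in L, forall x, e r x} -> {in L &, forall x y, ~~ e x y} ->
    gadget e w q b n s r (r |: L)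
| gadget_glue n s rA rB c (A B : {set V}) :
    gadget e w q b n.+1 s rA A -> gadget e w q b n s rB B ->
    glued e c rA rB A B -> w c = q -> gadget e w q b n.+1 s.+1 rA (c |: (A :|: B)).

(** * Edge count, rankings and centroid trees of gadgets *)

Section Gadgets.
Variables (V : finType) (e : rel V) (w : V -> R) (q b : R).
Hypothesis e_sym : symmetric e.
Hypothesis e_irr : irreflexive e.
Implicit Types (S : {set V}) (r : V) (t : rtree V).

Lemma gadget_root n s r S : gadget e w q b n s r S -> r \in S.
Proof. by elim=> [*|{}n {}s rA rB c A B _ rA_A *]; rewrite !inE ?eqxx ?rA_A ?orbT. Qed.

Lemma gadget_wsum n s r S : gadget e w q b n s r S -> wsum w S = q * size_of s.
Proof.
elim=> // {}n {}s rA rB c A B _ wA _ wB gAB wc.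
rewrite {1}/wsum (glued_sum gAB) -!/(wsum _ _) wA wB wc size_ofS; lra.
Qed.

Lemma gadget_connected n s r S : gadget e w q b n s r S -> connected e S.
Proof.
elim=> [{}n {}s {}r L _ _ _ _ rL _ | {}n {}s rA rB c A B gA cA gB cB gAB _].
  apply: (connected_hub e_sym (setU11 r L)) => x /setU1P[->|xL]; first exact: connect0.
  by apply: connect1; rewrite /rrel /= setU11 setU1r ?rL.
exact: (glued_connected e_sym (gadget_root gA) (gadget_root gB) cA cB gAB).
Qed.

(** [is_tree] counts ordered adjacent pairs. Gluing adds one vertex and four such pairs, two at [rA]
    and two at [rB]; adding 2 on the left avoids truncated subtraction. *)
Lemma gadget_card_edges n s r S : gadget e w q b n s r S ->
  ((\sum_(x in S) \sum_(y in S) e x y).+2 = #|S|.*2)%N.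
Proof.
elim=> [{}n {}s {}r L _ rL _ _ eL nL | {}n {}s rA rB c A B gA IA gB IB gAB _].
  rewrite big_setU1 //= big_setU1 //= e_irr add0n cardsU1 rL.
  rewrite (eq_bigr (fun=> 1)%N) => [|x xL]; last by rewrite eL.
  rewrite [X in (_ + X)%N](eq_bigr (fun=> 1)%N) => [|x xL].
    by rewrite !sum1_card add1n doubleS addnn.
  rewrite big_setU1 //= e_sym eL // big1 // => y yL.
  by rewrite (negPf (nL x y xL yL)).
have [nA nB dAB [eA eB nAB]] := gAB.
have delta (D : {set V}) d : d \in D -> {in D, forall x, e c x = (x == d)} ->
    (\sum_(x in D) e c x = 1)%N.
  move=> dD eD; rewrite (bigD1 d) //= eD // eqxx big1 // => x /andP[xD xd].
  by rewrite eD // (negPf xd).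
have cross (D E : {set V}) : {in D & E, forall x y, ~~ e x y} ->
    (\sum_(x in D) \sum_(y in E) e x y = 0)%N.
  by move=> nDE; rewrite big1 // => x xD; rewrite big1 // => y yE; rewrite (negPf (nDE x y xD yE)).
have cAr := delta A rA (gadget_root gA) eA.
have cBr := delta B rB (gadget_root gB) eB.
have nBA : {in B & A, forall x y, ~~ e x y} by move=> x y xB yA; rewrite e_sym nAB.
rewrite !(glued_big gAB) /= e_irr.
under [X in (_ + (X + _))%N]eq_bigr do rewrite (glued_big gAB) /= e_sym.
under [X in (_ + (_ + X))%N]eq_bigr do rewrite (glued_big gAB) /= e_sym.
rewrite !big_split /= cAr cBr (cross _ _ nAB) (cross _ _ nBA).
have -> : #|c |: (A :|: B)| = (#|A| + #|B|).+1.
  rewrite cardsU1 (glued_notin gAB) cardsU disjoint_setI0 // cards0 subn0.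
  by rewrite add1n.
by rewrite doubleS doubleD -IA -IB; lia.
Qed.

Hypothesis w_ge0 : forall x, 0 <= w x.
Hypothesis q_gt0 : 0 < q.
Hypothesis b_ge0 : 0 <= b.

(** A star gets rank 1 at its centre and 2 at its leaves, and [glued_ranking] joins the halves. It
    needs the root to be the only vertex of rank below 2, hence the extra conclusions. *)
Lemma gadget_ranking n s r S : gadget e w q b n s r S ->
  exists d : V -> R, [/\ ranking e S d, d r = 1, {in S, forall x, x != r -> 2 <= d x} &
    \sum_(x in S) w x * d x <= q * opt_bound b n s].
Proof.
elim=> [{}n {}s {}r L ns rL wS wL eL nL | {}n {}s rA rB c A B gA IA gB IB gAB wc].
  pose d x : R := if x == r then 1 else 2.
  have dr : d r = 1 by rewrite /d eqxx.
  have dL x : x != r -> d x = 2 by rewrite /d => /negPf->.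
  exists d; split=> // [|x _ /dL->//|].
    split=> [x _|X XS cX X0]; first by rewrite /d; case: eqP => _; lra.
    have [rX|rX] := boolP (r \in X).
      by exists r => // x _ /dL->; rewrite dr.
    have [y yX] := set0Pn _ X0.
    have XL x : x \in X -> x \in L.
      move=> xX; have /setU1P[xr|//] := subsetP XS x xX.
      by rewrite -xr xX in rX.
    have Xy : X \subset [set y].
      apply: (connected_closed cX yX (set11 y)) => u v /set1P-> _ vX uv.
      by have := nL y v (XL y yX) (XL v vX); rewrite uv.
    by exists y => // x /(subsetP Xy)/set1P->; rewrite eqxx.
  rewrite big_setU1 //= dr mulr1.
  have -> : \sum_(x in L) w x * d x = 2 * wsum w L.
    rewrite mulr_sumr; apply: eq_bigr => x xL; rewrite dL 1?mulrC //.
    by apply: contraNneq rL => <-.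
  rewrite wsumU1 // in wS.
  have := opt_bound_base b_ge0 ns; rewrite -(ler_pM2l q_gt0); lra.
have [dA [rkA dA1 dA2 cdA]] := IA; have [dB [rkB dB1 dB2 cdB]] := IB.
have rAA := gadget_root gA; have rBB := gadget_root gB.
have [d rk [dc dEA dEB]] := glued_ranking e_sym gAB rAA rBB rkA rkB dA1 dB1 dA2 dB2.
exists d; split=> // [|x|]; first by rewrite dEA.
  rewrite !inE => /or3P[/eqP->|xA|xB] xr; first by rewrite dc; lra.
    by rewrite dEA //; apply: dA2.
  by rewrite dEB //; have := rkB.1 x xB; lra.
rewrite (glued_sum gAB) dc wc.
under eq_bigr => x xA do rewrite dEA //.
under [X in _ + (_ + X)]eq_bigr => x xB do rewrite dEB // mulrDr mulr1.
rewrite big_split /= -/(wsum w B) (gadget_wsum gB).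
have := opt_boundS n s b_ge0; rewrite -(ler_pM2l q_gt0); lra.
Qed.

(** Equal halves force [c] to be the root of any centroid tree, so each gluing pays the full weight
    and passes to the two halves; a star is only charged its weight. *)
Lemma gadget_centroid_cost n s r S t : gadget e w q b n s r S ->
  stree_P e (centroid e w) S t -> q * centroid_bound n s <= cost w t.
Proof.
move=> g; elim: g t => [{}n {}s {}r L ns rL wS _ _ _ | {}n {}s rA rB c A B gA IA gB IB gAB wc] t tS.
  apply: le_trans (wsum_le_cost e_sym w_ge0 tS); rewrite wS ler_pM2l //.
  exact: centroid_bound_base.
have [v [f [vS cent fP ->]]] := stree_inv w e_sym tS.
have rAA := gadget_root gA; have rBB := gadget_root gB.
have cA := gadget_connected gA; have cB := gadget_connected gB.
have eAB : wsum w A = wsum w B by rewrite (gadget_wsum gA) (gadget_wsum gB).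
have wc0 : 0 < w c by rewrite wc.
have vc : v = c by exact: (glued_centroid_unique e_sym w_ge0 rAA rBB cA cB gAB wc0 eAB cent).
rewrite {}vc in fP *.
rewrite (sum_glued_components e_sym rAA rBB cA cB gAB) (gadget_wsum (gadget_glue gA gB gAB wc)).
have comps := glued_components e_sym rAA rBB cA cB gAB.
have := IA (f A); have := IB (f B).
move=> /(_ _)/wrap[|leB]; first by apply: fP; rewrite comps !inE eqxx orbT.
move=> /(_ _)/wrap[|leA]; first by apply: fP; rewrite comps !inE eqxx.
have := centroid_boundS n s; rewrite -(ler_pM2l q_gt0); lra.
Qed.

(** The inequality of [centroid_tree_le] with a numerical bound in place of the cost:
    [centroid_step] takes any [K], so no centroid tree of the gadget has to be exhibited. *)
Lemma gadget_ranking_cost n s r S d : gadget e w q b n s r S -> ranking e S d ->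
  q * centroid_bound n s + wsum w S <= 2 * \sum_(x in S) w x * d x.
Proof.
move=> g; elim: g d => [{}n {}s {}r L ns rL wS _ _ _ | {}n {}s rA rB c A B gA IA gB IB gAB wc] d dS.
  have : wsum w (r |: L) <= \sum_(x in r |: L) w x * d x.
    by apply: ler_sum => x xS; rewrite ler_peMr // dS.1.
  have := centroid_bound_base ns; rewrite -(ler_pM2l q_gt0); lra.
have rAA := gadget_root gA; have rBB := gadget_root gB.
have cA := gadget_connected gA; have cB := gadget_connected gB.
have eAB : wsum w A = wsum w B by rewrite (gadget_wsum gA) (gadget_wsum gB).
have gS := gadget_glue gA gB gAB wc.
have cent := glued_centroid e_sym w_ge0 rAA rBB cA cB gAB eAB.
pose K H : R := if H == A then q * centroid_bound n.+1 s else q * centroid_bound n s.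
have := centroid_step e_sym w_ge0 (gadget_connected gS) cent dS (K := K).
have BA : B == A = false by rewrite eq_sym (negPf (glued_neq rAA gAB)).
rewrite (sum_glued_components e_sym rAA rBB cA cB gAB) /K eqxx BA.
move=> /(_ _)/wrap[H d'|].
  rewrite (glued_components e_sym rAA rBB cA cB gAB) !inE.
  by case/orP=> /eqP->; rewrite ?eqxx ?BA; [apply: IA|apply: IB].
rewrite (gadget_wsum gS).
have := centroid_boundS n s; rewrite -(ler_pM2l q_gt0); lra.
Qed.

End Gadgets.

(** * Realising the gadgets on finite types *)

Lemma wsum_imset (V V' : finType) (f : V -> V') (w : V -> R) (w' : V' -> R) (A : {set V}) :
  injective f -> (forall x, w' (f x) = w x) -> wsum w' (f @: A) = wsum w A.
Proof.
move=> f_inj wE; rewrite /wsum big_imset /=; last by move=> x y _ _; apply: f_inj.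
by apply: eq_bigr => x _; apply: wE.
Qed.

Lemma gadget_imset (V V' : finType) (e : rel V) (e' : rel V') (w : V -> R) (w' : V' -> R)
    (f : V -> V') q b n s r (S : {set V}) :
  injective f -> (forall x y, e' (f x) (f y) = e x y) -> (forall x, w' (f x) = w x) ->
  gadget e w q b n s r S -> gadget e' w' q b n s (f r) (f @: S).
Proof.
move=> f_inj eE wE; elim=> [{}n {}s {}r L ns rL wS wL eL nL | {}n {}s rA rB c A B _ IA _ IB gAB wc].
  rewrite imsetU1; apply: gadget_star => //.
  - by rewrite mem_imset.
  - by rewrite -imsetU1 (wsum_imset _ f_inj wE).
  - by rewrite (wsum_imset _ f_inj wE).
  - by move=> _ /imsetP[x xL ->]; rewrite eE eL.
  - by move=> _ _ /imsetP[x xL ->] /imsetP[y yL ->]; rewrite eE nL.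
rewrite imsetU1 imsetU; have [nA nB dAB [eA eB nAB]] := gAB.
apply: gadget_glue IA IB _ _; last by rewrite wE.
split; rewrite ?mem_imset //.
  by rewrite imset_disjoint.
split=> [_ /imsetP[x xA ->]|_ /imsetP[x xB ->]|_ _ /imsetP[x xA ->] /imsetP[y yB ->]].
- by rewrite eE eA // inj_eq.
- by rewrite eE eB // inj_eq.
by rewrite eE nAB.
Qed.

(** [None] is the joining vertex [c]; the two summands carry the halves. *)
Definition glue_rel (VA VB : finType) (eA : rel VA) (eB : rel VB) (rA : VA) (rB : VB) :
    rel (option (VA + VB)) := fun x y =>
  match x, y with
  | None, Some (inl a) | Some (inl a), None => a == rA
  | None, Some (inr b) | Some (inr b), None => b == rB
  | Some (inl a), Some (inl a') => eA a a'
  | Some (inr b), Some (inr b') => eB b b'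
  | _, _ => false
  end.

Lemma size_ofE s : size_of s = (2 ^ s.+1 - 1)%:R.
Proof. by rewrite natrB ?expn_gt0 // natrX. Qed.

(** The induction is on [n + s], which drops for both halves. The leaves of a star carry weight only
    in the uniform version, selected by [u], hence the bound [u%:R]. *)
Lemma gadget_exists (u : bool) (q : R) n s : 0 < q ->
  exists (V : finType) (e : rel V) (w : V -> R) (r : V),
    [/\ symmetric e, irreflexive e, forall x, 0 < w x, u -> forall x, w x = q &
        gadget e w q u%:R n s r [set: V]].
Proof.
move=> q_gt0; have [m ms] := ubnP (n + s); elim: m => // m IHm in n s ms *.
have [ns|] := boolP ((n == 0)%N || (s == 0)%N).
  (* If [u] holds, [2 ^ s.+1 - 2] leaves and the centre make up [size_of s] vertices of weight [q];
     otherwise a single vertex takes all the weight. *)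
  pose l := if u then (2 ^ s.+1 - 2)%N else 0%N.
  pose q0 := if u then q else q * size_of s.
  have q0_gt0 : 0 < q0.
    by rewrite /q0; case: (u); rewrite // mulr_gt0 //; have := size_of_ge1 s; lra.
  have qE : q0 *+ l.+1 = q * size_of s.
    rewrite /q0 /l; case: (u); last by rewrite mulr1n.
    rewrite -mulr_natr size_ofE; congr (_ * _%:R).
    by have := leq_pexp2l (isT : (0 < 2)%N) (isT : (1 <= s.+1)%N); lia.
  exists (option 'I_l), (fun x y => (x == None) != (y == None)), (fun=> q0), None.
  split=> // [x y|x|uT|]; [by rewrite eq_sym | by rewrite eqxx | by rewrite /q0 uT |].
  rewrite -(setUCr [set None]); apply: gadget_star; rewrite ?inE //.
  - by rewrite setUCr /wsum sumr_const cardsT card_option card_ord.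
  - rewrite /wsum sumr_const cardsC1 card_option card_ord /= -qE.
    rewrite /l; case: (u); last by rewrite mulr0n mul0r.
    by rewrite mul1r mulrS lerDr ltW.
  - by move=> x; rewrite !inE => /negPf->.
  by move=> x y; rewrite !inE => /negPf-> /negPf->.
rewrite negb_or; case: n s => [|n] [|s] // in ms * => _.
have [|VA [eA [wA [rA [symA irrA wA0 wAu gA]]]]] := IHm n.+1 s; first by lia.
have [|VB [eB [wB [rB [symB irrB wB0 wBu gB]]]]] := IHm n s; first by lia.
pose e := glue_rel eA eB rA rB.
pose w x := match x with None => q | Some (inl a) => wA a | Some (inr b) => wB b end.
pose fA a : option (VA + VB) := Some (inl a); pose fB b : option (VA + VB) := Some (inr b).
have fA_inj : injective fA by move=> x y [].
have fB_inj : injective fB by move=> x y [].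
have notA x : fA x \in None |: (fA @: setT :|: fB @: setT) by rewrite !inE mem_imset ?inE ?orbT.
exists (option (VA + VB)), e, w, (fA rA); split.
- by move=> [[a|b]|] [[a'|b']|] //=; rewrite ?symA ?symB.
- by move=> [[a|b]|] //=.
- by move=> [[a|b]|] //=.
- by move=> uT [[a|b]|] //=; [apply: wAu | apply: wBu].
have -> : [set: option (VA + VB)] = None |: (fA @: setT :|: fB @: setT).
  apply/setP => -[[a|b]|]; rewrite !inE //=.
    by rewrite (mem_imset _ _ fA_inj) inE.
  by rewrite (mem_imset _ _ fB_inj) inE orbT.
apply: (gadget_glue (c := None)) => //.
- exact: gadget_imset fA_inj _ _ gA.
- exact: gadget_imset fB_inj _ _ gB.
split; first by apply/imsetP => -[].
- by apply/imsetP => -[].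
- apply/pred0P => x /=; apply/andP => -[/imsetP[a _ ->] /imsetP[b _]]; by [].
split=> [_ /imsetP[a _ ->]|_ /imsetP[b _ ->]|_ _ /imsetP[a _ ->] /imsetP[b _ ->]] //=.
Qed.

(** * From gadgets to instances with controlled optimum *)

Lemma gadget_tree (V : finType) (e : rel V) (w : V -> R) q b n s r :
  symmetric e -> irreflexive e -> gadget e w q b n s r [set: V] -> is_tree e.
Proof.
move=> e_sym e_irr g; split=> // [|x y|].
- by rewrite -cardsT; apply/card_gt0P; exists r.
- have := gadget_connected e_sym g (in_setT x) (in_setT y).
  by apply: connect_sub => u v /and3P[_ _]; apply: connect1.
have := gadget_card_edges e_sym e_irr g; rewrite cardsT.
have -> : #|[set p : V * V | e p.1 p.2]| = (\sum_(x in [set: V]) \sum_(y in [set: V]) e x y)%N.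
  rewrite -sum1_card big_mkcond (pair_big (fun x => x \in setT) (fun y => y \in setT)) /=.
  by apply: eq_big => [p|p _]; rewrite !inE //; case: (e _ _).
lia.
Qed.

(** Every search tree yields a ranking, so lower bounds valid for all rankings pass to the infimum
    [OPT]; the upper bound comes from the tree built from [gadget_ranking]. *)
Lemma gadget_OPT (V : finType) (e : rel V) (w : V -> R) q b n s r :
  symmetric e -> (forall x, 0 <= w x) -> 0 < q -> 0 <= b ->
  q * size_of s = 1 -> gadget e w q b n s r [set: V] ->
  [/\ q * centroid_bound n s + 1 <= 2 * OPT e w, OPT e w <= q * opt_bound b n s &
   forall t, centroid_tree e w t -> cost w t + 1 <= 2 * OPT e w].
Proof.
move=> e_sym w_ge0 q_gt0 b_ge0 qs g.
have wT := gadget_wsum g; rewrite qs in wT.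
have cT := gadget_connected e_sym g.
have T0 : [set: V] != set0 by apply/set0Pn; exists r.
have [d [dT _ _ dcost]] := gadget_ranking e_sym q_gt0 b_ge0 g.
have [t tT tcost] := stree_of_ranking e_sym w_ge0 T0 cT dT.
have OPT_ge (m : R) :
    (forall d', ranking e [set: V] d' -> m <= 2 * \sum_(x in [set: V]) w x * d' x) ->
    m <= 2 * OPT e w.
  move=> mP; suff: m / 2 <= OPT e w by lra.
  apply: lb_le_inf; first by exists (cost w t), t.
  move=> _ [t' [t'T ->]]; have [d' /mP d'm ->] := ranking_of_stree w e_sym t'T; lra.
split.
- by apply: OPT_ge => d' rd; have := gadget_ranking_cost e_sym w_ge0 q_gt0 g rd; rewrite wT.
- apply: le_trans dcost; apply: le_trans tcost; apply: ge_inf; last by exists t.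
  exists 0 => _ [t' [t'T ->]].
  exact: le_trans (wsum_ge0 w_ge0 _) (wsum_le_cost e_sym w_ge0 t'T).
move=> t' t'C; apply: OPT_ge => d' rd.
by have := centroid_tree_le e_sym w_ge0 cT t'C rd; rewrite wT.
Qed.

(** The ratio of [(3 / 2) ^+ s] to [2 ^+ s] is the inverse of [(4 / 3) ^+ s], whose growth
    Bernoulli's inequality makes explicit. *)
Lemma geometric_error (n : nat) (eps : R) : 0 < eps ->
  exists s, 6 * 2 ^+ n * (3 / 2) ^+ s <= eps * size_of s.
Proof.
move=> eps_gt0.
have bern k : 1 + k%:R / 3 <= (4 / 3) ^+ k :> R.
  elim: k => [|k IHk]; first by rewrite expr0 mul0r addr0.
  rewrite exprS -natr1; have : 0 <= k%:R :> R by []. lra.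
(* Chosen so that [x < s] gives [6 * 2 ^+ n / eps < s / 3], which is below [(4 / 3) ^+ s]. *)
pose x := 6 * 2 ^+ n / eps * 3.
have x_ge0 : 0 <= x by rewrite !mulr_ge0 ?invr_ge0 ?exprn_ge0 // ltW.
have [s xs] : exists s : nat, x < s%:R by exists (Num.bound x); apply: archi_boundP.
exists s.
have le43 : 6 * 2 ^+ n <= eps * (4 / 3) ^+ s.
  rewrite -ler_pdivrMl // mulrC; apply: le_trans (bern s).
  have -> : 6 * 2 ^+ n / eps = x / 3 by rewrite /x mulfK ?pnatr_eq0.
  by move: xs; move: (x) => y; lra.
have y_ge0 : 0 <= (3 / 2) ^+ s :> R by rewrite exprn_ge0 //; lra.
apply: le_trans (ler_wpM2r y_ge0 le43) _.
have e2 : 4 / 3 * (3 / 2) = 2 :> R by field.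
rewrite -mulrA -exprMn e2; apply: ler_wpM2l; first exact: ltW.
have : 1 <= 2 ^+ s :> R by apply: exprn_ege1; lra.
by rewrite /size_of exprS; lra.
Qed.

(** Taking [q] inverse to [size_of s] makes the total weight 1, and [s] is so large in terms of [n]
    and [eps] that both error terms fall below [eps]. *)
Lemma gadget_instance (u : bool) (n : nat) (eps : R) : 0 < eps -> exists I,
  [/\ valid_instance I, u -> uniform_instance I,
      n%:R + 1 - eps <= I_OPT I <= n%:R + 1 + u%:R + eps &
      forall C, I_centroid_tree C ->
        2 * n%:R + 1 - eps <= @I_cost I C /\ @I_cost I C + 1 <= 2 * I_OPT I].
Proof.
move=> eps_gt0; have [s es] := geometric_error n eps_gt0.
have size_gt0 : 0 < size_of s by have := size_of_ge1 s; lra.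
pose q := (size_of s)^-1; have q_gt0 : 0 < q by rewrite invr_gt0.
have qs : q * size_of s = 1 by rewrite mulVf ?gt_eqF.
have [V [e [w [r [e_sym e_irr w_gt0 wu g]]]]] := gadget_exists u n s q_gt0.
pose e' (i j : 'I_#|V|) := e (enum_val i) (enum_val j).
pose w' (i : 'I_#|V|) := w (enum_val i).
have e'_sym : symmetric e' by move=> i j; apply: e_sym.
have e'_irr : irreflexive e' by move=> i; apply: e_irr.
have w'_gt0 i : 0 < w' i by apply: w_gt0.
have w'_ge0 i : 0 <= w' i by apply: ltW.
have g' : gadget e' w' q u%:R n s (enum_rank r) [set: 'I_#|V|].
  have -> : [set: 'I_#|V|] = enum_rank @: [set: V].
    by apply/setP => i; rewrite inE -(enum_valK i) mem_imset ?inE //; apply: enum_rank_inj.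
  apply: gadget_imset g; first exact: enum_rank_inj.
    by move=> x y; rewrite /e' !enum_rankK.
  by move=> x; rewrite /w' enum_rankK.
have treeI := gadget_tree e'_sym e'_irr g'.
have wT := gadget_wsum g'; rewrite qs in wT.
have [OPTl OPTu OPTc] := gadget_OPT e'_sym w'_ge0 q_gt0 (ler0n _ u) qs g'.
have cbE : 2 * n%:R + 1 - eps <= q * centroid_bound n s.
  rewrite -(ler_pM2l size_gt0) mulrA [size_of s * q]mulrC qs mul1r /centroid_bound.
  have : 0 <= n%:R :> R by []. lra.
have obE : q * opt_bound u%:R n s <= n%:R + 1 + u%:R + eps.
  rewrite -(ler_pM2l size_gt0) mulrA [size_of s * q]mulrC qs mul1r /opt_bound.
  have : 0 <= 2 ^+ n * (3 / 2) ^+ s :> R by rewrite mulr_ge0 ?exprn_ge0 //; lra.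
  lra.
exists (Inst e' w'); split=> //.
- move=> uT; split=> //= i; have w'q j : w' j = q by apply: wu.
  (* All weights equal [q] and sum to 1, so [q] is the inverse of the number of vertices. *)
  have kq : q * #|'I_#|V| |%:R = q * size_of s.
    rewrite qs mulr_natr; apply: etrans wT.
    by rewrite /wsum (eq_bigr (fun=> q)) ?sumr_const ?cardsT // => j _; apply: w'q.
  by rewrite w'q div1r (mulfI (lt0r_neq0 q_gt0) kq).
- by rewrite /I_OPT /=; apply/andP; split; lra.
move=> C CT; split; last exact: OPTc.
exact: le_trans cbE (gadget_centroid_cost e'_sym w'_ge0 q_gt0 g' CT).
Qed.

Theorem theorem2 :
  (forall eps : R, 0 < eps ->
     exists I : nat -> instance,
       (forall n, valid_instance (I n)) /\
       diverges (fun n => I_OPT (I n)) /\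
       (forall n (C : rtree 'I_(inst_k (I n))), I_centroid_tree C ->
          2 * I_OPT (I n) - 1 - eps <= I_cost C))
  /\
  (exists I : nat -> instance,
     (forall n, uniform_instance (I n)) /\
     diverges (fun n => I_OPT (I n)) /\
     (forall C : forall n, rtree 'I_(inst_k (I n)),
        (forall n, I_centroid_tree (C n)) ->
        converges_to (fun n => I_cost (C n) / I_OPT (I n)) 2)).
Proof.
have bound_le (x : R) n : (Num.bound `|x| <= n)%N -> x < n%:R.
  move=> xn; apply: le_lt_trans (ler_norm x) _.
  by apply: lt_le_trans (archi_boundP (normr_ge0 x)) _; rewrite ler_nat.
split=> [eps eps_gt0|].
  (* One error of [eps / 3] in the cost and two in [2 * OPT] add up to [eps]. *)
  have eps3_gt0 : 0 < eps / 3 by rewrite divr_gt0.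
  have /choice[I IP] n := gadget_instance false n eps3_gt0.
  exists I; split; first by move=> n; have [] := IP n.
  split=> [M|n C CT].
    exists (Num.bound `|M + eps|) => n /bound_le Mn.
    have [_ _ /andP[OPTl _] _] := IP n; lra.
  have [_ _ /andP[_ +] /(_ C CT)[Cl _]] := IP n; rewrite mulr0n addr0; lra.
(* A fixed error of 1 is enough: the cost lies between [2 * n] and [2 * OPT - 1], and [OPT] between
   [n] and [n + 3], so the cost and [2 * OPT] differ by at most 6 while [OPT] grows. *)
have /choice[I IP] n := gadget_instance true n (@ltr01 R).
exists I; split; first by move=> n; have [_ /(_ isT)] := IP n.
split=> [M|C CT eps eps_gt0].
  exists (Num.bound `|M|) => n /bound_le Mn.
  have [_ _ /andP[OPTl _] _] := IP n; lra.
exists (maxn 1 (Num.bound `|6 / eps|)) => n; rewrite geq_max => /andP[n1 /bound_le neps].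
have [_ _ /andP[OPTl OPTu] /(_ _ (CT n))[Cl Cu]] := IP n; rewrite mulr1n in OPTu.
have n_ge1 : 1 <= n%:R :> R by rewrite ler1n.
have OPT_gt0 : 0 < I_OPT (I n) by lra.
rewrite ltr_pdivrMr // in neps.
have -> : I_cost (C n) / I_OPT (I n) - 2 = (I_cost (C n) - 2 * I_OPT (I n)) / I_OPT (I n).
  by rewrite mulrBl mulfK ?gt_eqF.
rewrite normrM normfV (gtr0_norm OPT_gt0) ltr_pdivrMr // ler0_norm; last by lra.
have : eps * n%:R <= eps * I_OPT (I n) by apply: ler_wpM2l; lra.
lra.
Qed.
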